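(* There exists a universal constant $c > 0$ such that the following holds. Let $V \in \mathbb{R}^{d \times n}$ be a doubly balanced frame and let $\lambda \in [0,1]$. If $V$ satisfies $(1-\lambda)$-$\infty$-expansion, then $V$ is a $(1 - c\lambda^{2})$-quantum expander.
   Context: A frame is a matrix $V = (v_1, \dots, v_n) \in \mathbb{R}^{d\times n}$ whose columns $v_j$ span $\mathbb{R}^d$. Its size is $s(V) := \|V\|_F^2$. $V$ is doubly balanced if $V V^T = \frac{s(V)}{d} I_d$ and $\|v_j\|_2^2 = \frac{s(V)}{n}$ for all $j \in [n]$. $V$ satisfies $(1-\lambda)$-$\infty$-expansion if for all $y \in \mathbb{R}^n$ with $\sum_j y_j = 0$ and $\|y\|_\infty \le 1$, \[ \Big\| \sum_{j=1}^n y_j v_j v_j^T \Big\|_{\mathrm{op}} \le \frac{s(V)(1-\lambda)}{d} . \] $V$ is a $(1-\mu)$-quantum expander if for all $y \in \mathbb{R}^n$ with $\sum_j y_j = 0$ and $\|y\|_2 \le 1$, \[ \Big\| \sum_{j=1}^n y_j v_j v_j^T \Big\|_{F} \le \frac{s(V)(1-\mu)}{\sqrt{dn}} . \] $\|\cdot\|_{\mathrm{op}}$ is the operator norm and $\|\cdot\|_F$ the Frobenius norm. *)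

(* Defs.v *)
From mathcomp Require Import all_boot all_order all_algebra.
From mathcomp Require Import all_classical all_reals all_analysis.
Import Order.TTheory GRing.Theory Num.Theory numFieldNormedType.Exports.

Set Implicit Arguments.
Unset Strict Implicit.
Unset Printing Implicit Defensive.

Local Open Scope classical_set_scope.
Local Open Scope ring_scope.

(** On row and column vectors this is the Euclidean norm.  The library norm
    [`|M|] on matrices is the maximum of the absolute values of the entries,
    hence the sup norm on vectors. *)
Definition fro_norm (R : realType) (m n : nat) (M : 'M[R]_(m, n)) : R :=
  Num.sqrt (\sum_(i < m) \sum_(j < n) M i j ^+ 2).

Definition op_norm (R : realType) (m n : nat) (M : 'M[R]_(m, n)) : R :=
  sup [set fro_norm (M *m x) | x in [set x : 'cV[R]_n | fro_norm x <= 1]].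

(** The columns of [V] span R^d, i.e. the row space of [V^T] is everything. *)
Definition is_frame (R : realType) (d n : nat) (V : 'M[R]_(d, n)) : Prop :=
  row_full V^T.

Definition frame_size (R : realType) (d n : nat) (V : 'M[R]_(d, n)) : R :=
  fro_norm V ^+ 2.

Definition doubly_balanced (R : realType) (d n : nat) (V : 'M[R]_(d, n)) :
    Prop :=
  V *m V^T = (frame_size V / d%:R)%:M /\
  forall j : 'I_n, fro_norm (col j V) ^+ 2 = frame_size V / n%:R.

Definition weighted_outer_sum (R : realType) (d n : nat) (V : 'M[R]_(d, n))
    (y : 'rV[R]_n) : 'M[R]_d :=
  \sum_(j < n) y 0 j *: (col j V *m (col j V)^T).

(** The parameter [e] stands for the whole quantity 1 - lambda. *)
Definition infty_expansion (R : realType) (d n : nat) (e : R)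
    (V : 'M[R]_(d, n)) : Prop :=
  forall y : 'rV[R]_n, \sum_(j < n) y 0 j = 0 -> `|y| <= 1 ->
    op_norm (weighted_outer_sum V y) <= frame_size V * e / d%:R.

(** The parameter [e] stands for the whole quantity 1 - mu. *)
Definition quantum_expander (R : realType) (d n : nat) (e : R)
    (V : 'M[R]_(d, n)) : Prop :=
  forall y : 'rV[R]_n, \sum_(j < n) y 0 j = 0 -> fro_norm y <= 1 ->
    fro_norm (weighted_outer_sum V y)
      <= frame_size V * e / Num.sqrt (d%:R * n%:R).

(* Main.v *)
(** Put [w i j = <v_i, v_j>^2]; double balance says that all rows of [w] sum to
    [D = s^2 / (d n)], and [|| sum_j y_j v_j v_j^T ||_F^2] is the quadratic form
    of [w] at [y].  Testing infinity-expansion on [y = 1] on [S] and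
    [y = - |S| / |S^c|] off [S], against the vectors [v_i] with [i] in [S], shows
    that every [S] with [2 |S| <= n] has [w]-cut at least [lambda / 2 * D |S|].
    Cheeger's inequality for the weighted graph [w] then gives a spectral gap of
    order [lambda^2]. *)
Require Import Defs.
From mathcomp Require Import all_boot all_order all_algebra.
From mathcomp Require Import all_classical all_reals all_analysis.
From mathcomp Require Import ring lra zify.
Import Order.TTheory GRing.Theory Num.Theory numFieldNormedType.Exports.

Local Open Scope ring_scope.

(** By Lagrange's identity, the difference of the two sides is half of a double sum of squares. *)
Lemma cauchy_schwarz_sum (R : realDomainType) (I : finType) (F G : I -> R) :
  (\sum_i F i * G i) ^+ 2 <= (\sum_i F i ^+ 2) * (\sum_i G i ^+ 2).
Proof.
have : 0 <= \sum_i \sum_j (F i * G j - F j * G i) ^+ 2.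
  by apply: sumr_ge0 => i _; apply: sumr_ge0 => j _; apply: sqr_ge0.
have -> : \sum_i \sum_j (F i * G j - F j * G i) ^+ 2
    = \sum_i \sum_j (F i ^+ 2 * G j ^+ 2)
      + \sum_i \sum_j (G i ^+ 2 * F j ^+ 2)
      - 2 * \sum_i \sum_j ((F i * G i) * (F j * G j)).
  rewrite mulr_sumr -big_split -sumrB; apply: eq_bigr => i _.
  rewrite mulr_sumr -big_split -sumrB; apply: eq_bigr => j _ /=; ring.
rewrite -!big_distrlr /=; nra.
Qed.

(** * Cheeger's inequality for a finite weighted graph with constant row sums *)

Section Cheeger.
Context {R : realFieldType} {T : finType}.
Variables (w : T -> T -> R) (D h : R).
Hypothesis w_ge0 : forall i j, 0 <= w i j.
Hypothesis w_sym : forall i j, w i j = w j i.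
Hypothesis w_row : forall i, \sum_j w i j = D.
Hypothesis h_ge0 : 0 <= h.
Hypothesis w_cut : forall S : {set T}, (2 * #|S| <= #|T|)%N ->
  h * D * #|S|%:R <= \sum_(i in S) \sum_(j in ~: S) w i j.

(** A layer-cake argument: [g] is a nonnegative combination of indicators of its superlevel sets.
    Each lies in the support, hence is small enough for [w_cut]. The induction on the size of the
    support removes one layer at a time. *)
Lemma coarea (g : T -> R) : (forall i, 0 <= g i) ->
  (2 * #|[set i | g i != 0%R]| <= #|T|)%N ->
  h * D * \sum_i g i <= \sum_i \sum_j w i j * Num.max 0 (g i - g j).
Proof.
have [k] := ubnP #|[set i | g i != 0%R]|.
elim: k g => // k IH g; rewrite ltnS => gk g0 gT.
set S := [set i | g i != 0%R] in gk gT.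
have [S0|[i0 i0S]] := set_0Vmem S.
  rewrite big1 ?mulr0 => [|i _]; last first.
    by apply/eqP; have := finset.in_set0 i; rewrite -S0 inE => /negbFE.
  apply: sumr_ge0 => i _; apply: sumr_ge0 => j _.
  by rewrite mulr_ge0 // le_max lexx.
have [i1 i1S i1min] := @Order.TotalTheory.arg_minP _ R T i0 (mem S) g i0S.
(* Both sides are additive when [m] times the indicator of the support is peeled
   off, and the peeled part is the cut of [S]. *)
pose m := g i1; pose chi i : R := (i \in S)%:R.
pose g' i := g i - m * chi i.
have gout i : i \notin S -> g i = 0 by rewrite inE negbK => /eqP.
have g'in i : i \in S -> g' i = g i - m by move=> iS; rewrite /g' /chi iS mulr1.
have g'out i : i \notin S -> g' i = 0.
  by move=> iS; rewrite /g' /chi (negbTE iS) mulr0 subr0 gout.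
have g'0 i : 0 <= g' i.
  have [iS|iS] := boolP (i \in S); last by rewrite g'out.
  by rewrite g'in // subr_ge0; apply: i1min.
have m0 : 0 <= m by exact: g0.
have g'S : [set i | g' i != 0%R] \proper S.
  apply/properP; split.
    apply/fintype.subsetP => i; rewrite inE; apply: contraR => iS.
    by rewrite g'out.
  by exists i1 => //; rewrite inE g'in // subrr eqxx.
have g'card := proper_card g'S.
have {}IH : h * D * \sum_i g' i
    <= \sum_i \sum_j w i j * Num.max 0 (g' i - g' j).
  apply: IH => //; first exact: leq_trans g'card gk.
  by apply: leq_trans gT; rewrite leq_mul2l /= ltnW.
have cutE : \sum_(i in S) \sum_(j in ~: S) w i j
    = \sum_i \sum_j w i j * (chi i * (1 - chi j)).
  rewrite big_mkcond; apply: eq_bigr => i _; rewrite big_mkcond /=.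
  rewrite /chi; case: (i \in S); last by rewrite big1 // => j _; rewrite mul0r mulr0.
  by apply: eq_bigr => j _; rewrite inE; case: (j \in S);
    rewrite ?subrr ?subr0 ?mulr1 ?mulr0.
have -> : \sum_i g i = \sum_i g' i + m * #|S|%:R.
  have -> : #|S|%:R = \sum_i chi i :> R.
    by rewrite -sum1_card natr_sum big_mkcond; apply: eq_bigr => i _;
      rewrite /chi; case: (i \in S).
  by rewrite mulr_sumr -big_split; apply: eq_bigr => i _ /=; rewrite /g' subrK.
have -> : \sum_i \sum_j w i j * Num.max 0 (g i - g j)
    = \sum_i \sum_j w i j * Num.max 0 (g' i - g' j)
      + m * \sum_i \sum_j w i j * (chi i * (1 - chi j)).
  rewrite mulr_sumr -big_split; apply: eq_bigr => i _ /=.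
  rewrite mulr_sumr -big_split; apply: eq_bigr => j _ /=.
  rewrite mulrCA -mulrDr; congr (_ * _).
  (* Only pairs going from [S] to its complement change. Inside [S] the shift by [m] cancels; with
     only [j] in [S] both maxima vanish, since [m] is the minimum of [g] on [S]. *)
  have [iS|iS] := boolP (i \in S); have [jS|jS] := boolP (j \in S).
  - rewrite !g'in // /chi iS jS subrr !mulr0 addr0.
    by congr Num.max; ring.
  - rewrite g'in // g'out // (gout j) // /chi iS (negbTE jS).
    by rewrite !subr0 !mulr1 !max_r ?subr_ge0 ?subrK ?i1min // g0.
  - rewrite g'out // g'in // (gout i) // /chi (negbTE iS) mul0r mulr0 addr0.
    by rewrite !max_l ?sub0r ?oppr_le0 // subr_ge0 i1min.
  - by rewrite !g'out // !gout // /chi (negbTE iS) mul0r mulr0 addr0.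
have := ler_wpM2l m0 (w_cut S gT); rewrite cutE => cut.
by rewrite mulrDr lerD // mulrCA.
Qed.

(** [coarea] is applied to the square of [g], and the differences of squares are split by AM-GM. *)
Lemma dirichlet_small_support (g : T -> R) : (forall i, 0 <= g i) ->
  (2 * #|[set i | g i != 0%R]| <= #|T|)%N ->
  h ^+ 2 / 4 * D * \sum_i g i ^+ 2 <= \sum_i \sum_j w i j * (g i - g j) ^+ 2.
Proof.
move=> g0 gT.
have gg : [set i | g i ^+ 2 != 0%R] = [set i | g i != 0%R].
  by apply/setP => i; rewrite !inE sqrf_eq0.
have := @coarea (fun i => g i ^+ 2) (fun i => sqr_ge0 _).
rewrite gg => /(_ gT) /(ler_wpM2l h_ge0).
have sumD : \sum_i \sum_j w i j * g i ^+ 2 = D * \sum_i g i ^+ 2.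
  by rewrite mulr_sumr; apply: eq_bigr => i _; rewrite -mulr_suml w_row.
have sumD' : \sum_i \sum_j w i j * g j ^+ 2 = D * \sum_i g i ^+ 2.
  by rewrite exchange_big -sumD; apply: eq_bigr => i _; apply: eq_bigr => j _;
    rewrite w_sym.
have : h * (\sum_i \sum_j w i j * Num.max 0 (g i ^+ 2 - g j ^+ 2))
    <= 2 * (\sum_i \sum_j w i j * (g i - g j) ^+ 2)
     + h ^+ 2 / 4 * (\sum_i \sum_j w i j * g i ^+ 2
                     + \sum_i \sum_j w i j * g j ^+ 2).
  rewrite -big_split /= !mulr_sumr -big_split; apply: ler_sum => i _ /=.
  rewrite -big_split /= !mulr_sumr -big_split; apply: ler_sum => j _ /=.
  suff : h * Num.max 0 (g i ^+ 2 - g j ^+ 2)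
      <= 2 * (g i - g j) ^+ 2 + h ^+ 2 / 4 * (g i ^+ 2 + g j ^+ 2).
    by move=> /(ler_wpM2l (w_ge0 i j)); lra.
  (* AM-GM: [h (a^2 - b^2) <= 2 (a - b)^2 + h^2 (a + b)^2 / 8] *)
  have p1 := sqr_ge0 (4 * (g i - g j) - h * (g i + g j)).
  have p2 := sqr_ge0 (h * (g i - g j)).
  have p3 := sqr_ge0 (h * g i); have p4 := sqr_ge0 (h * g j).
  have p5 := sqr_ge0 (g i - g j).
  by case: (leP 0 (g i ^+ 2 - g j ^+ 2)) => _; nra.
rewrite sumD sumD'.
(* The coarea bound contributes [h ^+ 2 * D * X], of which the AM-GM error takes half; dividing what
   remains by 2 gives the constant [h ^+ 2 / 4]. *)
set X := \sum_i g i ^+ 2; set Y := \sum_i _; set Z := \sum_i _; lra.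
Qed.

(** The median is the least value of [f] with at most half of the points strictly above it. The next
    lower value, if any, has more than half above it, so fewer than half lie below the median. *)
Lemma median_exists (f : T -> R) : (0 < #|T|)%N ->
  exists m, (2 * #|[set i | (m < f i)%R]| <= #|T|)%N /\
            (2 * #|[set i | (f i < m)%R]| <= #|T|)%N.
Proof.
move=> /card_gt0P[i0 _].
pose up i := [set j | (f i < f j)%R].
have [i1 _ i1max] := @Order.TotalTheory.arg_maxP _ R T i0 predT f isT.
have i1P : (2 * #|up i1| <= #|T|)%N.
  rewrite [up i1](_ : _ = finset.set0) ?cards0 ?muln0 //.
  by apply/setP => j; rewrite !inE ltNge (i1max j isT : f j <= f i1).
have [i2 i2P i2min] :=
  @Order.TotalTheory.arg_minP _ R T i1 (fun i => 2 * #|up i| <= #|T|)%N f i1P.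
exists (f i2); split => //.
have [->|[j]] := set_0Vmem [set i | (f i < f i2)%R].
  by rewrite cards0 muln0.
rewrite inE => jlt.
have [k klt kmax] :=
  @Order.TotalTheory.arg_maxP _ R T j (fun i => f i < f i2) f jlt.
have kN : (#|T| < 2 * #|up k|)%N.
  by rewrite ltnNge; apply/negP => /i2min; rewrite leNgt klt.
have sub : (#|[set i | (f i < f i2)%R]| <= #|~: up k|)%N.
  apply/subset_leq_card/fintype.subsetP => i; rewrite !inE => /kmax.
  by rewrite -leNgt.
have := cardsC (up k); lia.
Qed.

(** Cutting [f] at a median leaves a positive part [p] and a negative part [q], both with support
    small enough for [dirichlet_small_support]. *)
Lemma cheeger (f : T -> R) : \sum_i f i = 0 ->
  h ^+ 2 / 4 * D * \sum_i f i ^+ 2 <= \sum_i \sum_j w i j * (f i - f j) ^+ 2.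
Proof.
move=> f0; have [T0|Tpos] := posnP #|T|.
  by rewrite !big_pred0 ?mulr0 // => i; have := fintype0 i T0.
have [m [mup mdown]] := median_exists f Tpos.
pose p i := Num.max 0 (f i - m); pose q i := Num.max 0 (m - f i).
have p0 i : 0 <= p i by rewrite le_max lexx.
have q0 i : 0 <= q i by rewrite le_max lexx.
have pT : (2 * #|[set i | p i != 0%R]| <= #|T|)%N.
  rewrite (_ : [set i | p i != 0%R] = [set i | (m < f i)%R]) //.
  apply/setP => i; rewrite !inE /p.
  case: (ltP m (f i)) => fm; last by rewrite max_l ?eqxx // subr_le0.
  by rewrite max_r ?subr_ge0 ?ltW // subr_eq0 gt_eqF.
have qT : (2 * #|[set i | q i != 0%R]| <= #|T|)%N.
  rewrite (_ : [set i | q i != 0%R] = [set i | (f i < m)%R]) //.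
  apply/setP => i; rewrite !inE /q.
  case: (ltP (f i) m) => fm; last by rewrite max_l ?eqxx // subr_le0.
  by rewrite max_r ?subr_ge0 ?ltW // subr_eq0 gt_eqF.
have := lerD (dirichlet_small_support p p0 pT) (dirichlet_small_support q q0 qT).
have D0 : 0 <= D.
  have /card_gt0P[i0 _] := Tpos.
  by rewrite -(w_row i0) sumr_ge0.
(* As [f] has mean zero, shifting it by [m] only increases its square sum. *)
have mass : \sum_i f i ^+ 2 <= \sum_i p i ^+ 2 + \sum_i q i ^+ 2.
  have : \sum_i (f i ^+ 2 - 2 * m * f i) <= \sum_i (p i ^+ 2 + q i ^+ 2).
    apply: ler_sum => i _; have m2 := sqr_ge0 m.
    by rewrite /p /q; case: (leP 0 (f i - m)) => ?; case: (leP 0 (m - f i)) => ?; nra.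
  by rewrite big_split /= sumrN -mulr_sumr f0 mulr0 subr0 big_split.
(* Since [f i - m = p i - q i], and [p] increases with [f] while [q] decreases, the cross term
   [- 2 * (p i - p j) * (q i - q j)] is nonnegative. *)
have energy : \sum_i \sum_j w i j * (p i - p j) ^+ 2
      + \sum_i \sum_j w i j * (q i - q j) ^+ 2
    <= \sum_i \sum_j w i j * (f i - f j) ^+ 2.
  rewrite -big_split; apply: ler_sum => i _ /=.
  rewrite -big_split; apply: ler_sum => j _ /=; rewrite -mulrDr.
  apply: ler_wpM2l => //; rewrite /p /q.
  by case: (leP 0 (f i - m)) => ?; case: (leP 0 (f j - m)) => ?;
    case: (leP 0 (m - f i)) => ?; case: (leP 0 (m - f j)) => ?; nra.
have c0 : 0 <= h ^+ 2 / 4 * D by rewrite mulr_ge0 // divr_ge0 ?sqr_ge0.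
have := ler_wpM2l c0 mass; rewrite mulrDr; lra.
Qed.

End Cheeger.

(** * Frobenius and operator norms *)

Section Norms.
Context {R : realType}.

Lemma fro_norm_ge0 m n (M : 'M[R]_(m, n)) : 0 <= fro_norm M.
Proof. exact: sqrtr_ge0. Qed.

Lemma sqr_fro_norm m n (M : 'M[R]_(m, n)) :
  fro_norm M ^+ 2 = \sum_i \sum_j M i j ^+ 2.
Proof.
by rewrite sqr_sqrtr // sumr_ge0 // => i _; rewrite sumr_ge0 // => j _;
  exact: sqr_ge0.
Qed.

Lemma sqr_fro_norm_col n (x : 'cV[R]_n) : fro_norm x ^+ 2 = \sum_i x i 0 ^+ 2.
Proof. by rewrite sqr_fro_norm; apply: eq_bigr => i _; rewrite big_ord1. Qed.

(** Cauchy-Schwarz on each row. This bounds the set in [op_norm], so that its [sup] is a genuine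
    least upper bound. *)
Lemma fro_norm_mulmx_col m n (M : 'M[R]_(m, n)) (x : 'cV[R]_n) :
  fro_norm (M *m x) <= fro_norm M * fro_norm x.
Proof.
rewrite -(@ler_pXn2r _ 2) ?nnegrE ?mulr_ge0 ?fro_norm_ge0 //.
rewrite exprMn !sqr_fro_norm_col sqr_fro_norm mulr_suml.
by apply: ler_sum => i _; rewrite mxE; apply: cauchy_schwarz_sum.
Qed.

Lemma fro_normZ m n (a : R) (M : 'M[R]_(m, n)) : 0 <= a ->
  fro_norm (a *: M) = a * fro_norm M.
Proof.
move=> a0; apply/eqP.
rewrite -(@eqrXn2 _ 2) ?mulr_ge0 ?fro_norm_ge0 // exprMn !sqr_fro_norm.
apply/eqP; rewrite mulr_sumr; apply: eq_bigr => i _.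
by rewrite mulr_sumr; apply: eq_bigr => j _; rewrite mxE exprMn.
Qed.

Lemma fro_norm_op_norm m n (M : 'M[R]_(m, n)) (x : 'cV[R]_n) :
  fro_norm (M *m x) <= op_norm M * fro_norm x.
Proof.
have [x0|xn0] := eqVneq (fro_norm x) 0.
  by have := fro_norm_mulmx_col _ _ M x; rewrite x0 !mulr0.
have xp : 0 < fro_norm x by rewrite lt0r xn0 fro_norm_ge0.
rewrite -ler_pdivrMr // mulrC -fro_normZ ?invr_ge0 ?fro_norm_ge0 // scalemxAr.
apply: ub_le_sup.
  exists (fro_norm M) => _ [z /= z1 <-].
  apply: le_trans (fro_norm_mulmx_col _ _ M z) _.
  by rewrite ler_piMr // fro_norm_ge0.
exists ((fro_norm x)^-1 *: x) => //=.
by rewrite fro_normZ ?invr_ge0 ?fro_norm_ge0 // mulVf.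
Qed.

Lemma quad_form_op_norm n (M : 'M[R]_n) (x : 'cV[R]_n) :
  \sum_a \sum_b x a 0 * M a b * x b 0 <= op_norm M * fro_norm x ^+ 2.
Proof.
have -> : \sum_a \sum_b x a 0 * M a b * x b 0 = \sum_a x a 0 * (M *m x) a 0.
  apply: eq_bigr => a _; rewrite mxE mulr_sumr.
  by apply: eq_bigr => b _; rewrite mulrA.
apply: le_trans (_ : fro_norm x * fro_norm (M *m x) <= _); last first.
  rewrite expr2 mulrCA ler_wpM2l ?fro_norm_ge0 //.
  exact: fro_norm_op_norm.
apply: le_trans (ler_norm _) _.
rewrite -(@ler_pXn2r _ 2) ?nnegrE ?mulr_ge0 ?fro_norm_ge0 //.
by rewrite real_normK ?num_real // exprMn !sqr_fro_norm_col cauchy_schwarz_sum.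
Qed.

End Norms.

(** * The weighted graph of a frame *)

Section Frame.
Context {R : realType} {d n : nat}.
Variable V : 'M[R]_(d, n).

Definition gram_sqr (i j : 'I_n) : R := (\sum_a V a i * V a j) ^+ 2.

Lemma gram_sqr_sym i j : gram_sqr i j = gram_sqr j i.
Proof. by congr (_ ^+ 2); apply: eq_bigr => a _; rewrite mulrC. Qed.

Lemma weighted_outer_sumE (y : 'rV[R]_n) a b :
  weighted_outer_sum V y a b = \sum_j y 0 j * (V a j * V b j).
Proof.
by rewrite summxE; apply: eq_bigr => j _; rewrite !mxE big_ord1 !mxE.
Qed.

(** Testing the matrix against the column [i] itself turns an operator norm bound into a bound on
    row [i] of the weights. *)
Lemma quad_form_weighted_outer_sum (y : 'rV[R]_n) i :
  \sum_a \sum_b col i V a 0 * weighted_outer_sum V y a b * col i V b 0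
  = \sum_j y 0 j * gram_sqr i j.
Proof.
under eq_bigr => a _ do under eq_bigr => b _ do
  rewrite weighted_outer_sumE mulr_sumr mulr_suml.
under eq_bigr => a _ do rewrite exchange_big.
rewrite exchange_big; apply: eq_bigr => j _ /=.
rewrite /gram_sqr expr2 big_distrlr mulr_sumr; apply: eq_bigr => a _ /=.
by rewrite mulr_sumr; apply: eq_bigr => b _; rewrite !mxE; ring.
Qed.

(** The Frobenius inner product of two rank-one matrices [v_i v_i^T] and [v_j v_j^T] is the squared
    inner product of [v_i] and [v_j]. *)
Lemma sqr_fro_norm_weighted_outer_sum (y : 'rV[R]_n) :
  fro_norm (weighted_outer_sum V y) ^+ 2
  = \sum_i \sum_j gram_sqr i j * (y 0 i * y 0 j).
Proof.
rewrite sqr_fro_norm.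
under eq_bigr => a _ do under eq_bigr => b _ do
  rewrite weighted_outer_sumE expr2 big_distrlr /=.
under eq_bigr => a _ do (rewrite exchange_big /=;
  under eq_bigr => i _ do rewrite exchange_big /=).
rewrite exchange_big; apply: eq_bigr => i _ /=.
rewrite exchange_big; apply: eq_bigr => j _ /=.
rewrite /gram_sqr expr2 big_distrlr mulr_suml; apply: eq_bigr => a _ /=.
by rewrite mulr_suml; apply: eq_bigr => b _; ring.
Qed.

Lemma gram_sqr_row : doubly_balanced V -> forall i,
  \sum_j gram_sqr i j = frame_size V / d%:R * (frame_size V / n%:R).
Proof.
move=> [VV Vcol] i; rewrite -(Vcol i) sqr_fro_norm_col mulr_sumr.
(* With all weights 1 the outer sum is [V *m V^T], a scalar matrix by double balance. *)
have -> : \sum_j gram_sqr i j = \sum_j (const_mx 1 : 'rV[R]_n) 0 j * gram_sqr i j.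
  by apply: eq_bigr => j _; rewrite mxE mul1r.
rewrite -quad_form_weighted_outer_sum; apply: eq_bigr => a _.
have outer1 b : weighted_outer_sum V (const_mx 1) a b
    = (frame_size V / d%:R)%:M a b.
  rewrite weighted_outer_sumE -VV mxE; apply: eq_bigr => j _.
  by rewrite !mxE mul1r.
rewrite (bigD1 a) //= big1 => [|b ba]; rewrite outer1 [_%:M _ _]mxE.
  by rewrite eqxx mulr1n addr0; ring.
by rewrite eq_sym (negbTE ba) mulr0n mulr0 mul0r.
Qed.

Lemma gram_sqr_cut (lambda : R) : 0 <= lambda -> doubly_balanced V ->
  infty_expansion (1 - lambda) V ->
  forall S : {set 'I_n}, (2 * #|S| <= #|'I_n|)%N ->
  lambda / 2 * (frame_size V / d%:R * (frame_size V / n%:R)) * #|S|%:R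
    <= \sum_(i in S) \sum_(j in ~: S) gram_sqr i j.
Proof.
move=> l0 bal expV S; rewrite card_ord => Sn.
set D := frame_size V / d%:R * _.
(* A nonempty [S] with [2 * #|S| <= n] has a nonempty complement, so the division in [t] is
   genuine. *)
have [->|Sn0] := eqVneq S finset.set0.
  by rewrite cards0 mulr0 big_set0.
have Spos : (0 < #|S|)%N by rewrite card_gt0.
have cardC : (#|S| + #|~: S| = n)%N by rewrite cardsC card_ord.
have Cpos : 0 < #|~: S|%:R :> R by rewrite ltr0n; lia.
have SC : #|S|%:R <= #|~: S|%:R :> R by rewrite ler_nat; lia.
pose t : R := #|S|%:R / #|~: S|%:R.
have t01 : 0 <= t <= 1 by rewrite divr_ge0 //= ler_pdivrMr // mul1r.
pose y : 'rV[R]_n := \row_j (if j \in S then 1 else - t).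
have split_sum (F : 'I_n -> R) :
    \sum_j F j = \sum_(j in S) F j + \sum_(j in ~: S) F j.
  by rewrite (bigID (mem S)) /=; congr (_ + _); apply: eq_bigl => j; rewrite inE.
have yS (F : 'I_n -> R) : \sum_j y 0 j * F j
    = \sum_(j in S) F j - t * \sum_(j in ~: S) F j.
  rewrite split_sum mulr_sumr -sumrN; congr (_ + _); apply: eq_bigr => j jS.
    by rewrite mxE jS mul1r.
  by move: jS; rewrite inE mxE => /negbTE->; rewrite mulNr.
have y0 : \sum_j y 0 j = 0.
  under eq_bigr => j _ do rewrite -[y 0 j]mulr1.
  rewrite yS !sumr_const -mulr_natr mul1r -mulr_natr mul1r /t.
  by rewrite divfK ?subrr // gt_eqF.
have y1 : `|y| <= 1.
  rewrite /Num.Def.normr /= mx_normrE; apply: bigmax_le => //= -[i j] _ /=.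
  by rewrite mxE; case: (j \in S); rewrite ?normrN ger0_norm //; lra.
(* The left side is the quadratic form at column [i]: row [i] sums to [D], so its part in [S] is [D]
   minus its part outside. *)
have row i : i \in S -> D - (1 + t) * \sum_(j in ~: S) gram_sqr i j
    <= D * (1 - lambda).
  move=> iS; have := quad_form_op_norm _ (weighted_outer_sum V y) (col i V).
  rewrite quad_form_weighted_outer_sum yS => quad.
  have := split_sum (gram_sqr i); rewrite gram_sqr_row // -/D => DE.
  have op := ler_wpM2r (sqr_ge0 (fro_norm (col i V))) (expV y y0 y1).
  have -> : D * (1 - lambda)
      = frame_size V * (1 - lambda) / d%:R * fro_norm (col i V) ^+ 2.
    by rewrite (proj2 bal) /D; ring.
  apply: le_trans op; apply: le_trans quad; lra.
have cut0 : 0 <= \sum_(i in S) \sum_(j in ~: S) gram_sqr i j.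
  by apply: sumr_ge0 => i _; apply: sumr_ge0 => j _; apply: sqr_ge0.
have : \sum_(i in S) (D - (1 + t) * \sum_(j in ~: S) gram_sqr i j)
    <= \sum_(i in S) D * (1 - lambda) by apply: ler_sum.
rewrite sumrB !sumr_const -mulr_sumr -[D *+ _]mulr_natr
  -[(D * _) *+ _]mulr_natr.
set C := \sum_(i in S) _ in cut0 *.
(* The summed inequality says that [lambda * D * #|S|] is at most [(1 + t) * C], hence at most
   [2 * C]; this is the origin of [lambda / 2]. *)
move: t01 => /andP[_ t1]; have := ler_wpM2r cut0 t1; lra.
Qed.

End Frame.

(** * From the spectral gap to quantum expansion *)

Theorem theorem6p2 (R : realType) :
  exists c : R, 0 < c /\
    forall (d n : nat) (V : 'M[R]_(d, n)) (lambda : R),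
      is_frame V -> doubly_balanced V -> 0 <= lambda <= 1 ->
      infty_expansion (1 - lambda) V ->
      quantum_expander (1 - c * lambda ^+ 2) V.
Proof.
(* Cheeger with [h = lambda / 2] has constant [lambda ^+ 2 / 16]. The Dirichlet form counts the gap
   twice, leaving [lambda ^+ 2 / 32] for the squared norm, and [(1 - x) ^+ 2 >= 1 - 2 * x] halves
   this once more. *)
exists (64^-1); split; first by rewrite invr_gt0.
move=> d n V lambda _ bal /andP[l0 l1] expV y y0 y1.
set s := frame_size V; set D := s / d%:R * (s / n%:R).
have s0 : 0 <= s by exact: sqr_ge0.
have D0 : 0 <= D by rewrite mulr_ge0 // divr_ge0.
have l2 : 0 <= lambda ^+ 2 <= 1 by rewrite sqr_ge0 expr_le1.
have ysq : \sum_i y 0 i ^+ 2 <= 1.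
  have -> : \sum_i y 0 i ^+ 2 = fro_norm y ^+ 2 by rewrite sqr_fro_norm big_ord1.
  by rewrite expr_le1 // fro_norm_ge0.
have rhs0 : 0 <= s * (1 - 64^-1 * lambda ^+ 2) / Num.sqrt (d%:R * n%:R).
  by rewrite divr_ge0 ?sqrtr_ge0 // mulr_ge0 //; lra.
rewrite -(@ler_pXn2r _ 2) ?nnegrE ?fro_norm_ge0 //.
(* This also covers [d = 0] and [n = 0]: the inverse of 0 is 0, so both sides vanish. *)
have -> : (s * (1 - 64^-1 * lambda ^+ 2) / Num.sqrt (d%:R * n%:R)) ^+ 2
    = D * (1 - 64^-1 * lambda ^+ 2) ^+ 2.
  rewrite exprMn exprVn sqr_sqrtr ?mulr_ge0 // invfM /D; ring.
have row := gram_sqr_row V bal.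
have := cheeger (gram_sqr V) D (lambda / 2) (fun i j => sqr_ge0 _)
  (gram_sqr_sym V) row (divr_ge0 l0 (ler0n _ 2))
  (gram_sqr_cut V lambda l0 bal expV) (fun i => y 0 i) y0.
(* Expanding the square, the constant row sums and symmetry evaluate both diagonal terms, and the
   cross term is the Frobenius norm squared. *)
have -> : \sum_i \sum_j gram_sqr V i j * (y 0 i - y 0 j) ^+ 2
    = 2 * (D * \sum_i y 0 i ^+ 2)
      - 2 * fro_norm (weighted_outer_sum V y) ^+ 2.
  rewrite sqr_fro_norm_weighted_outer_sum.
  have diag : \sum_i \sum_j gram_sqr V i j * y 0 i ^+ 2 = D * \sum_i y 0 i ^+ 2.
    by rewrite mulr_sumr; apply: eq_bigr => i _; rewrite -mulr_suml row.
  have diag' : \sum_i \sum_j gram_sqr V i j * y 0 j ^+ 2 = D * \sum_i y 0 i ^+ 2.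
    rewrite exchange_big -diag; apply: eq_bigr => i _; apply: eq_bigr => j _.
    by rewrite gram_sqr_sym.
  rewrite mulr_natl mulr2n -{1}diag -diag' -big_split mulr_sumr -sumrB.
  apply: eq_bigr => i _ /=; rewrite -big_split mulr_sumr -sumrB.
  by apply: eq_bigr => j _ /=; ring.
set Y := \sum_i _ in ysq *; set F := fro_norm _ ^+ 2 => gap.
have le1 : D * (1 - lambda ^+ 2 / 32) * Y <= D * (1 - lambda ^+ 2 / 32).
  by rewrite ler_piMr // mulr_ge0 //; lra.
have le2 : D * (1 - lambda ^+ 2 / 32) <= D * (1 - 64^-1 * lambda ^+ 2) ^+ 2.
  by rewrite ler_wpM2l //; have := sqr_ge0 (lambda ^+ 2); nra.
apply: le_trans (le_trans le1 le2).
by move: gap; rewrite exprMn; lra.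
Qed.
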